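(* Let $p$ be a prime and let $G$ be a finite $p$-group such that $\mathrm{cod}(G)=\{1,p,p^b,p^a\}$ where $2\le b<a$. If any of the following hold, then $G$ has nilpotence class at most $4$: (i) $|\mathrm{cd}(G)|=2$; (ii) $\mathrm{cd}(G)=\{1,p,p^2\}$; (iii) $|G:G'|=p^2$.
   Context: For an irreducible complex character $\chi$ of a finite group $G$, the codegree of $\chi$ is $\mathrm{cod}(\chi)=|G:\ker\chi|/\chi(1)$. $\mathrm{cod}(G)$ denotes the set of codegrees of the irreducible characters of $G$, and $\mathrm{cd}(G)$ denotes the set of degrees $\chi(1)$ of the irreducible characters of $G$. $G'$ is the derived subgroup of $G$. *)

(* Defs.v *)
From mathcomp Require Import all_boot all_order all_algebra all_fingroup all_solvable all_field all_character.
Set Implicit Arguments. Unset Strict Implicit. Unset Printing Implicit Defensive.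
Import GRing.Theory Num.Theory.
Local Open Scope ring_scope.

Definition codeg (gT : finGroupType) (G : {group gT}) (i : Iirr G) : algC :=
  (#|G : cfker 'chi[G]_i|%g)%:R / 'chi[G]_i 1%g.

Definition cod (gT : finGroupType) (G : {group gT}) : seq algC :=
  undup [seq codeg i | i : Iirr G].

Definition cd (gT : finGroupType) (G : {group gT}) : seq algC :=
  undup [seq 'chi[G]_i 1%g | i : Iirr G].

(* Main.v *)
Require Import Defs.
From mathcomp Require Import all_boot all_order all_algebra all_fingroup all_solvable all_field all_character.
From mathcomp Require Import zify.

(* A p-group with codegrees in {1, p, p^a} has class at most 2.  If a <= 2, then a
   faithful chi forces |G| <= p^3.  Let a >= 3; given a faithful chi of G with
   L_3(G) <> 1, choose psi with L_3(G) and Z(G) in its kernel K but G' not in K.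
   Then psi(1)^2 = |G : Z(psi)|, and comparing the codegrees of chi
   and psi forces |Z(psi) : K| >= p |K|, while the cyclic group Z(psi) / K has
   order at most p^2 because G / G' is elementary abelian.  So K = Z(G) has order
   p and Z(psi)^p is central, contradicting |Z(psi) : K| = p^2.
   For four codegrees, if b = 2 and a = 3 then chi(1)^2 p <= |G : ker chi| gives
   |G : ker chi| <= p^5, whence class at most 4.  Otherwise all characters of
   codegree p^a are nonlinear.  If L_5(G) <> 1, the kernels
   ker chi_5 < ker chi_4 < ker chi_3 of characters with L_i(G) not in ker chi_i, and
   a character of codegree p^a and degree p^d over ker chi_3, give
   |G : ker chi_5| >= p^(a+d+2), too large when the degrees are as in (i) or (ii).
   Under (iii) and class at least 3 there are quotients of order p^3 and p^4 and of
   maximal class, so p^2 and p^3 are codegrees and b = 2, a = 3. *)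

Set Implicit Arguments.
Unset Strict Implicit.
Unset Printing Implicit Defensive.
Import GRing.Theory Num.Theory.
Local Open Scope ring_scope.

Section PGroupCodegrees.
Local Open Scope group_scope.
Implicit Type gT : finGroupType.

(** * Kernels of irreducible characters and codegrees of quotients *)

Lemma expg_index gT (M N : {group gT}) x :
  N <| M -> x \in M -> x ^+ #|M : N| \in N.
Proof.
move=> /andP[_ nNM] Mx; have Nx := subsetP nNM x Mx.
rewrite coset_idr ?groupX // morphX //; apply/eqP; rewrite -order_dvdn.
by rewrite -card_quotient // order_dvdG // mem_quotient.
Qed.

(** [N] is the intersection of the kernels of the irreducible characters whose kernel contains
    it. *)
Lemma irr_separates gT (G N : {group gT}) (A : {set gT}) :
  N <| G -> ~~ (A \subset N) ->
  exists i : Iirr G, N \subset cfker 'chi_i /\ ~~ (A \subset cfker 'chi_i).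
Proof.
move=> nsNG; rewrite -{1}(cap_cfker_normal nsNG) => sA.
have [/existsP[i /andP[]] | /existsPn noi] :=
  boolP [exists i : Iirr G, (N \subset cfker 'chi_i) && ~~ (A \subset cfker 'chi_i)].
  by exists i.
case/negP: sA; apply/bigcapsP=> i sNi.
by have:= noi i; rewrite sNi negbK.
Qed.

Lemma index_cfker_mod gT (G N : {group gT}) (i : Iirr (G / N)) :
  N <| G -> #|G : cfker 'chi_(mod_Iirr i)| = #|G / N : cfker 'chi_i|.
Proof.
move=> nsNG; have sNK := cfker_mod 'chi_i nsNG.
rewrite mod_IirrE // -(quotient_cfker_mod G 'chi_i nsNG) index_quotient_eq //.
- by rewrite subIset ?sNK ?orbT.
- exact: cfker_sub.
exact: normal_norm.
Qed.

Lemma codeg_mod gT (G N : {group gT}) (i : Iirr (G / N)) :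
  N <| G -> codeg (mod_Iirr i) = codeg i.
Proof. by move=> nsNG; rewrite /codeg index_cfker_mod // mod_IirrE // cfMod1. Qed.

(** Turns every later comparison of characters into linear arithmetic on the exponents of [p]. *)
Variant codeg_spec gT (G : {group gT}) (i : Iirr G) (p : nat) : Prop :=
  CodegSpec n d z of #|G : cfker 'chi_i| = (p ^ n)%N
    & #|'Z('chi_i)%CF : cfker 'chi_i| = (p ^ z)%N
    & 'chi_i 1 = (p ^ d)%:R%R
    & codeg i = (p ^ (n - d))%:R%R
    & (z + d.*2 <= n)%N & (0 < n -> 0 < z)%N
    & (0 < d)%N = ~~ (G^`(1) \subset cfker 'chi_i)
    & (abelian (G / 'Z('chi_i)%CF) -> (z + d.*2)%N = n).

(** With Z the center and K the kernel of chi, [z + d.*2 <= n] is the bound chi(1)^2 <= |G : Z|, an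
    equality when G / Z is abelian. Moreover Z / K is the center of the [p]-group G / K, so [z] is
    positive unless G = K. *)
Lemma codegP gT (G : {group gT}) (i : Iirr G) p :
  prime p -> p.-group G -> codeg_spec i p.
Proof.
move=> p_pr pG; set K := cfker 'chi_i; set Z := 'Z('chi_i)%CF.
have p_gt1 := prime_gt1 p_pr.
have nsKZ : K <| Z := cfker_center_normal _.
have nsZG : Z <| G := cfcenter_normal _.
have /p_natP[n Dn] : p.-nat #|G : K| := pnat_dvd (dvdn_indexg _ _) pG.
have /p_natP[z Dz] : p.-nat #|Z : K|.
  exact: pnat_dvd (dvdn_indexg _ _) (pgroupS (cfcenter_sub _) pG).
have /p_natP[m Dm] : p.-nat #|G : Z| := pnat_dvd (dvdn_indexg _ _) pG.
have Dnzm : n = (z + m)%N.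
  apply: (expnI p_gt1); rewrite expnD -Dn -Dm -Dz mulnC.
  by rewrite Lagrange_index ?cfcenter_sub ?normal_sub.
have /p_natP[d Dd] : p.-nat (irr_degree (socle_of_Iirr i)).
  by apply: pnat_dvd pG; have:= dvd_irr1_cardG i; rewrite irr1_degree dvdC_nat.
have D1 : 'chi_i 1 = (p ^ d)%:R%R by rewrite irr1_degree Dd.
have le_dm : (d.*2 <= m)%N.
  rewrite -(leq_exp2l _ _ p_gt1) -Dm -(ler_nat algC) -muln2 expnM natrX -D1.
  by case: (irr1_bound i).
have le_dn : (d <= n)%N.
  by rewrite Dnzm (leq_trans _ (leq_addl _ _)) // (leq_trans _ le_dm) // -addnn leq_addr.
apply: (@CodegSpec _ _ _ _ n d z) => //.
- by rewrite /codeg -/K Dn D1 -natf_div ?dvdn_exp2l // ?expnB ?prime_gt0 //.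
- by rewrite Dnzm leq_add2l.
- move=> n_gt0; rewrite lt0n; apply: contraL n_gt0 => /eqP z0.
  have eqKZ : K = Z.
    by apply/eqP; rewrite eqEsubset normal_sub //= -indexg_eq1 Dz z0.
  have: 'Z(G / K) = 1 by rewrite -(cfcenter_eq_center i) -/K -/Z -eqKZ trivg_quotient.
  move/(trivg_center_pgroup (quotient_pgroup _ pG))/eqP.
  rewrite -subG1 quotient_sub1 ?cfker_norm //= -indexg_eq1 -/K Dn.
  by rewrite -[1%N](expn0 p) eqn_exp2l ?lt0n ?negbK.
- by rewrite -lin_irr_der1 qualifE /= irr_char D1 pnatr_eq1 -[1%N](expn0 p)
    eqn_exp2l ?lt0n.
- move=> abGZ; rewrite Dnzm; congr (_ + _)%N; apply: (expnI p_gt1).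
  apply/eqP; rewrite -Dm -(eqr_nat algC) -(irr1_abelian_bound abGZ) D1.
  by rewrite -natrX -expnM muln2.
Qed.

(** * Codegrees of linear characters *)

(** Inflate a faithful linear character of the cyclic quotient of order [p ^ k]. *)
Lemma codeg_cyclic gT (G : {group gT}) p n k :
    prime p -> cyclic G -> #|G| = (p ^ n)%N -> (k <= n)%N ->
  exists j : Iirr G, codeg j = (p ^ k)%:R%R.
Proof.
move=> p_pr cG oG le_kn; have pG : p.-group G by rewrite /pgroup oG pnatX pnat_id.
have [|M [_ nsMG oM]] := @normal_pgroup p _ (n - k) G G pG (normal_refl G).
  by rewrite oG pfactorK ?leq_subr.
have cQ : cyclic (G / M) := quotient_cyclic _ cG.
have [j /trivgP ker_j] : exists j : Iirr (G / M), cfaithful 'chi_j.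
  apply: pgroup_cyclic_faithful (quotient_pgroup M pG) _.
  exact: cyclicS (center_sub _) cQ.
have lin_j : 'chi_j \is a linear_char.
  exact/char_abelianP/cyclic_abelian.
exists (mod_Iirr j); rewrite codeg_mod // /codeg (lin_char1 lin_j) divr1 ker_j.
rewrite indexg1 card_quotient ?normal_norm //.
rewrite -divgS ?normal_sub // oG oM -expnB ?prime_gt0 ?leq_subr //.
by rewrite subKn.
Qed.

(** The quotient by the kernel is abelian with a faithful irreducible character, hence cyclic. *)
Lemma codeg_linear gT (G : {group gT}) (i : Iirr G) p n k :
    prime p -> G^`(1) \subset cfker 'chi_i -> #|G : cfker 'chi_i| = (p ^ n)%N ->
    (k <= n)%N ->
  exists j : Iirr G, codeg j = (p ^ k)%:R%R.
Proof.
move=> p_pr sG'K oGK le_kn; set K := cfker 'chi_i in sG'K oGK.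
have nsKG : K <| G := cfker_normal _.
have abGK : abelian (G / K) by rewrite sub_der1_abelian.
have cycGK : cyclic (G / K).
  by rewrite -[G / K](center_idP abGK) -cfcenter_eq_center cfcenter_cyclic.
have [|j Dj] := @codeg_cyclic _ (G / K)%G p n k p_pr cycGK _ le_kn.
  by rewrite card_quotient ?normal_norm.
by exists (mod_Iirr j); rewrite codeg_mod.
Qed.

(** If [x ^+ p] is not in G', some linear character does not have it in its kernel. The quotient by
    that kernel is cyclic of order at least p^2, so p^2 is a codegree. *)
Lemma expg_der1 gT (G : {group gT}) p :
    prime p -> p.-group G -> (forall i : Iirr G, codeg i != (p ^ 2)%:R%R) ->
  {in G, forall x, x ^+ p \in G^`(1)}.
Proof.
move=> p_pr pG no2 x Gx; have [//|G'xp] := boolP (x ^+ p \in G^`(1)).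
have [|i [sG'K]] := @irr_separates _ G G^`(1)%G [set x ^+ p] (der_normal 1 G).
  by rewrite sub1set.
have [n _ _ Dn _ _ _ _ _ _ _] := codegP i p_pr pG.
rewrite sub1set; have [n_le1 | n_gt1] := leqP n 1; last first.
  have [j Dj] := codeg_linear p_pr sG'K Dn n_gt1.
  by have:= no2 j; rewrite Dj eqxx.
case/negP; have:= expg_index (cfker_normal 'chi_i) Gx; rewrite Dn.
case: n n_le1 {Dn} => [|[|//]] _; rewrite ?expn1 // expn0 expg1; exact: groupX.
Qed.

Lemma cyclic_index_dvd gT (M N : {group gT}) m :
    N <| M -> cyclic (M / N) -> {in M, forall x, x ^+ m \in N} ->
  (#|M : N| %| m)%N.
Proof.
move=> nsNM /cyclicP[Nx defMN] Xm; have nNM := normal_norm nsNM.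
have: Nx \in M / N by rewrite defMN cycle_id.
case/morphimP=> x Nx' Mx DNx; rewrite -card_quotient // defMN DNx.
by rewrite -orderE order_dvdn -morphX //= coset_id ?Xm.
Qed.

(** * Commutators modulo a kernel containing the third lower central term *)

Lemma der1_sub_cfcenter gT (G : {group gT}) (i : Iirr G) :
  'L_3(G) \subset cfker 'chi_i -> G^`(1) \subset 'Z('chi_i)%CF.
Proof.
move=> sL3K; have nKG : G \subset 'N(cfker 'chi_i) := cfker_norm _.
rewrite -(quotientSGK _ (normal_sub (cfker_center_normal _))); last first.
  exact: subset_trans (der_sub 1 G) nKG.
rewrite cfcenter_eq_center subsetI quotientS ?der_sub //.
by rewrite quotient_cents2 ?(subset_trans (der_sub 1 G)).
Qed.

(** Otherwise L_3 = [G', G] lies in [Z(G) L_3, G] = L_4, which nilpotency forbids for a nontrivial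
    L_3. *)
Lemma der1_not_sub_center_lcn3 gT (G : {group gT}) :
  nilpotent G -> 'L_3(G) != 1 -> ~~ (G^`(1) \subset 'Z(G) <*> 'L_3(G)).
Proof.
move=> nilG; apply: contra => sG'; have nL4 := lcn_norm 4 G.
suffices sL3 : 'L_3(G) \subset 'L_4(G).
  move/forallP: nilG => /(_ ('L_3(G))%G); rewrite /= subsetI lcn_sub.
  by rewrite -lcnSn sL3.
rewrite {1}lcnSn lcn2 -quotient_cents2 ?(subset_trans (der_sub 1 G)) //.
apply: subset_trans (quotientS _ sG') _.
rewrite quotientY ?(subset_trans (lcn_sub _ _)) ?(subset_trans (center_sub _)) //.
rewrite join_subG quotient_cents ?subsetIr //=.
by rewrite quotient_cents2 ?(subset_trans (lcn_sub _ _)) // -lcnSn.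
Qed.

(** Modulo the kernel commutators are central, so [x, y]^p = [x^p, y], which lies in [G', G] =
    L_3. *)
Lemma expg_der1_cfker gT (G : {group gT}) (i : Iirr G) p :
    prime p -> p.-group G -> {in G, forall x, x ^+ p \in G^`(1)} ->
    'L_3(G) \subset cfker 'chi_i ->
  {in G^`(1), forall x, x ^+ p \in cfker 'chi_i}.
Proof.
move=> p_pr pG Gp sL3K u G'u; set K := cfker 'chi_i in sL3K *.
have nKG : G \subset 'N(K) := cfker_norm _.
have sG'Z := der1_sub_cfcenter sL3K.
have cycZK : cyclic ('Z('chi_i)%CF / K) := cfcenter_cyclic _.
have pZK : p.-group ('Z('chi_i)%CF / K).
  by rewrite quotient_pgroup // (pgroupS (cfcenter_sub _)).
have Gu : u \in G := subsetP (der_sub 1 G) u G'u.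
have nKu : u \in 'N(K) := subsetP nKG u Gu.
rewrite coset_idr ?groupX // morphX //.
(* [Ohm_1] of an abelian [p]-group has exponent dividing [p], so only the generating commutators
   need checking. *)
suffices sG'Ohm : G^`(1) / K \subset 'Ohm_1('Z('chi_i)%CF / K).
  have /abelemP[//|_ ->//] := Ohm1_abelem pZK (cyclic_abelian cycZK).
  exact: subsetP sG'Ohm _ (mem_quotient _ G'u).
rewrite quotient_der // gen_subG; apply/subsetP=> _ 
  /imset2P[_ _ /morphimP[x nKx Gx ->] /morphimP[y nKy Gy ->] ->].
have Gxy : [~ x, y] \in G^`(1) := mem_commg Gx Gy.
rewrite -morphR //; have /= -> := OhmE 1 pZK; rewrite mem_gen // inE.
rewrite mem_quotient ?(subsetP sG'Z) //=.
have cxxy : commute (coset K x) [~ coset K x, coset K y].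
  have: coset K [~ x, y] \in 'Z(G / K).
    by rewrite -cfcenter_eq_center mem_quotient ?(subsetP sG'Z).
  by case/centerP=> _; rewrite morphR // => cxy; apply/commute_sym/cxy/mem_quotient.
rewrite expn1 inE morphR //= -commXg // -morphX // -morphR ?groupX //=.
rewrite coset_id // (subsetP sL3K) // lcnSn lcn2 mem_commg ?Gp //.
Qed.

(** * Groups with codegrees among 1, p, p^a *)

Lemma lcnS_eq1 gT (G : {group gT}) n : 'L_n(G) = 1 -> 'L_n.+1(G) = 1.
Proof. by move=> Ln; apply/trivgP; rewrite -Ln lcn_subS. Qed.

Lemma eq_natr_exp p m n :
  prime p -> ((p ^ m)%:R == (p ^ n)%:R :> algC)%R = (m == n).
Proof. by move=> p_pr; rewrite eqr_nat eqn_exp2l ?prime_gt1. Qed.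

Lemma natr_exp_eq1 p m : prime p -> ((p ^ m)%:R == 1 :> algC)%R = (m == 0)%N.
Proof. by move=> p_pr; rewrite -(eq_natr_exp m 0 p_pr) expn0. Qed.

Lemma natr_exp_eqp p m :
  prime p -> ((p ^ m)%:R == p%:R :> algC)%R = (m == 1)%N.
Proof. by move=> p_pr; rewrite -(eq_natr_exp m 1 p_pr) expn1. Qed.

Lemma nil_class_three_codeg_faithful gT (G : {group gT}) (i : Iirr G) p a :
    prime p -> p.-group G -> cfker 'chi_i = 1 ->
    (forall j : Iirr G, codeg j \in [:: 1; p%:R; (p ^ a)%:R]%R) ->
  (nil_class G <= 2)%N.
Proof.
move=> p_pr pG ker_i codG; have nilG := pgroup_nil pG.
have p_gt1 := prime_gt1 p_pr.
apply/lcn_nil_classP=> //; apply/eqP/idPn=> ntL3.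
have exp_codG (j : Iirr G) m : codeg j = (p ^ m)%:R%R -> [|| m == 0, m == 1 | m == a]%N.
  move=> Dj; have:= codG j; rewrite Dj !inE.
  by rewrite natr_exp_eq1 // natr_exp_eqp // eq_natr_exp.
have ntG' : ~~ (G^`(1) \subset cfker 'chi_i).
  by rewrite ker_i subG1 /= -lcn2; apply: contra ntL3 => /eqP/lcnS_eq1->.
have [n d z Dn Dz _ codi le_n z_gt0 d_gt0 _] := codegP i p_pr pG.
rewrite ntG' in d_gt0; rewrite ker_i indexg1 in Dn.
have Da : (n - d)%N = a by move: (exp_codG _ _ codi) le_n z_gt0 d_gt0; clear; lia.
have [a_le2 | a_gt2] := leqP a 2.
  case/eqP: ntL3; apply/(lcn_nil_classP 2 nilG).
  apply: leq_trans (nil_class_pgroup pG) _; rewrite Dn pfactorK //.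
  (* From 1 + 2d <= n = a + d comes d <= a - 1 <= 1, so n <= 3. *)
  by move: Da a_le2 le_n z_gt0 d_gt0; clear; lia.
have Gp : {in G, forall x, x ^+ p \in G^`(1)}.
  by apply: expg_der1 => // j; apply/eqP=> /exp_codG; move: a_gt2; clear; lia.
have [|j [sNK ntG'j]] :=
  @irr_separates _ G ('Z(G) <*> 'L_3(G))%G _ _ (der1_not_sub_center_lcn3 nilG ntL3).
  rewrite /normal join_subG center_sub lcn_sub /= normsY ?lcn_norm //.
  exact: normal_norm (center_normal G).
set K := cfker 'chi_j in sNK ntG'j.
have [sZK sL3K] : 'Z(G) \subset K /\ 'L_3(G) \subset K.
  by apply/andP; rewrite -join_subG.
have nKG : G \subset 'N(K) := cfker_norm _.
have nsKZ : K <| 'Z('chi_j)%CF := cfker_center_normal _.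
have sZG : 'Z('chi_j)%CF \subset G := cfcenter_sub _.
have cycZK : cyclic ('Z('chi_j)%CF / K) := cfcenter_cyclic _.
have sG'Z := der1_sub_cfcenter sL3K.
have [n' d' z' Dn' Dz' _ codj le_n' z'_gt0 d'_gt0 eq_n'] := codegP j p_pr pG.
rewrite -/K ntG'j in Dn' Dz' d'_gt0.
have Da' : (n' - d')%N = a by move: (exp_codG _ _ codj) le_n' z'_gt0 d'_gt0; clear; lia.
have {}eq_n' := eq_n' (sub_der1_abelian sG'Z).
have /p_natP[k Dk] : p.-nat #|K| by rewrite -/(p.-group K) (pgroupS (cfker_sub _)).
have Dnk : n = (k + n')%N.
  by apply: (expnI p_gt1); rewrite -Dn expnD -Dk -Dn' Lagrange ?cfker_sub.
have oZ : #|'Z(G)| = (p ^ z)%N.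
  rewrite -Dz ker_i indexg1 /= cfcenter_fful_irr //.
  by rewrite cfaithfulE ker_i.
have le_zk : (z <= k)%N.
  by rewrite -(leq_exp2l _ _ p_gt1) -oZ -Dk subset_leq_card.
(* For x in Z(psi), x^p lies in G', and p-th powers of elements of G' lie in [K]. *)
have z'_le2 : (z' <= 2)%N.
  rewrite -(dvdn_Pexp2l _ _ p_gt1) -Dz' cyclic_index_dvd // => x Zx.
  rewrite expnS expn1 expgM; apply: expg_der1_cfker => //.
  by rewrite Gp // (subsetP sZG).
(* Equal codegrees give d = d' + k, and z + d <= a = z' + d'. Hence z + k <= z' <= 2, and 1 <= z <=
   k forces z = k = 1 and z' = 2. *)
have eqZK : 'Z(G) = K.
  apply/eqP; rewrite eqEcard sZK oZ Dk leq_exp2l //.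
  by move: Da Da' eq_n' Dnk le_n le_n' z_gt0 d_gt0 le_zk z'_le2; clear; lia.
(* For x in Z(psi), [x, y] lies in [K] = Z(G) of order p, so [x^p, y] = [x, y]^p = 1 and x^p lies in
   [K]. *)
have: (z' <= 1)%N.
  rewrite -(dvdn_Pexp2l _ _ p_gt1) -Dz' cyclic_index_dvd // => x Zx.
  rewrite expn1 /= -/K -eqZK; apply/centerP; have Gx := subsetP sZG x Zx.
  split=> [|y Gy]; first exact: groupX.
  have Kxy : [~ x, y] \in 'Z(G).
    rewrite eqZK; move: (mem_quotient K Zx).
    rewrite cfcenter_eq_center => /centerP[_ cx].
    apply: coset_idr; first by rewrite (subsetP nKG) ?groupR.
    rewrite morphR ?(subsetP nKG) //; apply/eqP/commgP/cx.
    exact: mem_quotient.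
  have /centerP[_ cxy] := Kxy.
  apply/commgP; rewrite commXg; last exact/commute_sym/cxy.
  rewrite -order_dvdn (_ : p = #|'Z(G)|) ?order_dvdG // oZ.
  rewrite (_ : z = 1%N) ?expn1 //.
  by move: Da Da' eq_n' Dnk le_n le_n' z_gt0 d_gt0 le_zk z'_le2; clear; lia.
by move: Da Da' eq_n' Dnk le_n le_n' z_gt0 d_gt0 le_zk; clear; lia.
Qed.

Lemma lcn_sub_nil_class_quotient gT (G N : {group gT}) m :
    nilpotent G -> N <| G -> (nil_class (G / N) <= m)%N ->
  'L_m.+1(G) \subset N.
Proof.
move=> nilG /andP[_ nNG] le_m.
have LN := lcn_nil_classP m (quotient_nil N nilG) le_m.
rewrite -quotient_sub1 ?(subset_trans (lcn_sub _ _)) // subG1; apply/eqP.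
exact: etrans (morphim_lcn (coset_morphism N) m.+1 nNG) LN.
Qed.

(** Reduces to the faithful case: codegrees of a quotient are codegrees of [G]. *)
Lemma nil_class_three_codeg gT (G : {group gT}) p a :
    prime p -> p.-group G ->
    (forall j : Iirr G, codeg j \in [:: 1; p%:R; (p ^ a)%:R]%R) ->
  (nil_class G <= 2)%N.
Proof.
move=> p_pr pG codG; have nilG := pgroup_nil pG.
apply/lcn_nil_classP=> //; apply/trivgP; apply: contraT => ntL3.
have [i [_ /negP[]]] := irr_separates (normal1 G) ntL3; set K := cfker 'chi_i.
have nsKG : K <| G := cfker_normal _.
have ker1 : cfker 'chi_(quo_Iirr K i) = 1.
  by apply/trivgP; rewrite quo_IirrE // -cfaithfulE cfaithful_quo.
apply: (lcn_sub_nil_class_quotient nilG nsKG).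
apply: nil_class_three_codeg_faithful p_pr (quotient_pgroup K pG) ker1 _ => j.
by rewrite -codeg_mod.
Qed.

(** * Kernels and the lower central series *)

(** A group of order p^n has class at most max(1, n - 1); the 1 accounts for [1 < m]. *)
Lemma lcn_sub_index gT (G N : {group gT}) p n m :
    prime p -> p.-group G -> N <| G -> #|G : N| = (p ^ n)%N ->
    (n <= m)%N -> (1 < m)%N ->
  'L_m(G) \subset N.
Proof.
case: m => [|[|m]] // p_pr pG nsNG oGN le_nm _.
apply: (lcn_sub_nil_class_quotient (pgroup_nil pG) nsNG).
apply: leq_trans (nil_class_pgroup (quotient_pgroup N pG)) _.
rewrite /= card_quotient ?normal_norm // oGN pfactorK //.
by move: le_nm; clear; lia.
Qed.

Lemma lcn_not_sub_der1 gT (G : {group gT}) (A : {set gT}) n :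
  (1 < n)%N -> ~~ ('L_n(G) \subset A) -> ~~ (G^`(1) \subset A).
Proof.
by move=> n_gt1; apply: contra; rewrite -lcn2; apply/subset_trans/lcn_sub_leq.
Qed.

Lemma nil_class_codeg_le3 gT (G : {group gT}) p :
    prime p -> p.-group G ->
    (forall (j : Iirr G) m, codeg j = (p ^ m)%:R%R -> (m <= 3)%N) ->
  (nil_class G <= 4)%N.
Proof.
move=> p_pr pG codG; have nilG := pgroup_nil pG.
apply/lcn_nil_classP=> //; apply/trivgP; apply: contraT => ntL5.
have [i [_ ntL5i]] := irr_separates (normal1 G) ntL5.
have [n d z Dn _ _ Dc le_n z_gt0 d_gt0 _] := codegP i p_pr pG.
rewrite (lcn_not_sub_der1 _ ntL5i) // in d_gt0.
case/negP: ntL5i; apply: (lcn_sub_index p_pr pG (cfker_normal _) Dn) => //.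
(* 1 + 2d <= n <= d + 3 yields d <= 2 and n <= 5. *)
by move: (codG _ _ Dc) le_n z_gt0 d_gt0; clear; lia.
Qed.

(** The center of chi modulo its kernel is central, so it cannot contain L_{n+1}. A character with
    that center in its kernel is then chosen; the center is strictly larger than the kernel, so the
    index drops. *)
Lemma lcn_cfker_lift gT (G : {group gT}) (i : Iirr G) p n :
    prime p -> p.-group G -> ~~ ('L_n.+2(G) \subset cfker 'chi_i) ->
  exists j : Iirr G, (#|G : cfker 'chi_j| < #|G : cfker 'chi_i|)%N
    /\ ~~ ('L_n.+1(G) \subset cfker 'chi_j).
Proof.
move=> p_pr pG ntL; set K := cfker 'chi_i in ntL *; set Z := 'Z('chi_i)%CF.
have nKG : G \subset 'N(K) := cfker_norm _.
have ntLZ : ~~ ('L_n.+1(G) \subset Z).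
  apply: contra ntL => sLZ.
  rewrite lcnSn -quotient_cents2 ?(subset_trans (lcn_sub _ _)) //.
  apply: subset_trans (quotientS K sLZ) _.
  by rewrite /Z /K cfcenter_eq_center subsetIr.
have [j [sZj ntLj]] := irr_separates (cfcenter_normal 'chi_i) ntLZ.
exists j; split=> //.
have [n' d z Dn Dz _ _ _ z_gt0 _ _] := codegP i p_pr pG.
have n'_gt0 : (0 < n')%N.
  rewrite lt0n; apply: contra ntL => /eqP n'0.
  have sGK : G \subset K by rewrite -indexg_eq1 Dn n'0.
  exact: subset_trans (lcn_sub _ _) sGK.
have sKZ : K \subset Z := normal_sub (cfker_center_normal _).
have leZ : (#|G : cfker 'chi_j| <= #|G : Z|)%N by rewrite dvdn_leq ?indexgS.
apply: leq_ltn_trans leZ _.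
rewrite /K -(Lagrange_index (cfcenter_sub _) sKZ) /= ltn_Pmulr ?indexg_gt0 //.
by rewrite Dz -[1%N](expn0 p) ltn_exp2l ?prime_gt1 // z_gt0.
Qed.

(** The quotient by the kernel has class at least 3, so three codegrees do not suffice for it. *)
Lemma codeg_fourth gT (G : {group gT}) (i : Iirr G) p b :
    prime p -> p.-group G -> ~~ ('L_3(G) \subset cfker 'chi_i) ->
  exists j : Iirr G, cfker 'chi_i \subset cfker 'chi_j
    /\ codeg j \notin [:: 1; p%:R; (p ^ b)%:R]%R.
Proof.
move=> p_pr pG ntL3; set K := cfker 'chi_i in ntL3 *.
have nsKG : K <| G := cfker_normal _.
have [/existsP[j Cj] | /existsPn noj] := boolP
    [exists j : Iirr (G / K), codeg j \notin [:: 1; p%:R; (p ^ b)%:R]%R].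
  exists (mod_Iirr j); rewrite codeg_mod //; split=> //.
  by rewrite mod_IirrE // cfker_mod.
case/negP: ntL3; apply: (lcn_sub_nil_class_quotient (pgroup_nil pG) nsKG).
apply: (nil_class_three_codeg p_pr (quotient_pgroup K pG)) => j.
exact: negbNE (noj j).
Qed.

Lemma codeg_small_quotient gT (G N : {group gT}) p n :
    prime p -> p.-group G -> N <| G -> (#|G : N| <= p ^ n.+1)%N ->
    (1 < n <= 3)%N -> ~~ ('L_n(G) \subset N) ->
  exists i : Iirr G, codeg i = (p ^ n)%:R%R.
Proof.
move=> p_pr pG nsNG leN /andP[n_gt1 n_le3] ntLn.
have [i [sNK ntLK]] := irr_separates nsNG ntLn; exists i.
have [m d z Dm _ _ -> le_m z_gt0 d_gt0 _] := codegP i p_pr pG.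
rewrite (lcn_not_sub_der1 n_gt1 ntLK) in d_gt0.
have le_mn : (m <= n.+1)%N.
  rewrite -(leq_exp2l _ _ (prime_gt1 p_pr)) -Dm.
  by apply: leq_trans leN; rewrite dvdn_leq ?indexgS.
have lt_nm : (n < m)%N.
  rewrite ltnNge; apply: contra ntLK => le_m_n.
  exact: lcn_sub_index p_pr pG (cfker_normal _) Dm le_m_n n_gt1.
suffices -> : (m - d)%N = n by [].
(* Here m = n + 1 <= 4, so 1 + 2d <= m leaves only d = 1. *)
by move: le_m z_gt0 d_gt0 le_mn lt_nm n_le3; clear; lia.
Qed.

(** * Derived subgroup of index p^2 *)

(** If H / H' is cyclic, H is abelian. Otherwise two elements x, y generate H, so the central
    subgroup H' is generated by [x, y], and [x, y]^p = [x^p, y] = 1 because x^p lies in H'. *)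
Lemma card_der1_class2 gT (H : {group gT}) p :
    prime p -> p.-group H -> 'L_3(H) = 1 -> #|H : H^`(1)| = (p ^ 2)%N ->
  (#|H^`(1)| <= p)%N.
Proof.
move=> p_pr pH L3 oHH'; have [p_gt0 p_gt1] := (prime_gt0 p_pr, prime_gt1 p_pr).
have nsH'H : H^`(1) <| H := der_normal 1 H.
have sH'H := normal_sub nsH'H; have nH'H := normal_norm nsH'H.
have sH'Z : H^`(1) \subset 'Z(H).
  rewrite subsetI sH'H /=; apply/commG1P.
  by rewrite -lcn2 -lcnSn.
have [cycHH' | ncycHH'] := boolP (cyclic (H / H^`(1))).
  have cycH := cyclic_nilpotent_quo_der1_cyclic (pgroup_nil pH) cycHH'.
  by rewrite (derG1P (cyclic_abelian cycH)) cards1.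
have [x Hx H'x] : exists2 x, x \in H & x \notin H^`(1).
  apply/subsetPn; rewrite -indexg_eq1 oHH'.
  by rewrite -[1%N](expn0 p) eqn_exp2l.
pose M := (<[x]> <*> H^`(1))%G.
have sMH : M \subset H by rewrite join_subG cycle_subG Hx.
have sH'M : H^`(1) \subset M := joing_subr _ _.
have nsMH : M <| H by rewrite sub_der1_normal.
have nsH'M : H^`(1) <| M := normalS sH'M sMH nsH'H.
have Mx : x \in M by rewrite -cycle_subG joing_subl.
have [y Hy M'y] : exists2 y, y \in H & y \notin M.
  apply/subsetPn; apply: contra ncycHH' => sHM.
  have defM : M :=: H by apply/eqP; rewrite eqEsubset sMH.
  have <- : M / H^`(1) = H / H^`(1) := congr1 (fun A => A / H^`(1)) defM.
  rewrite /= quotientYidr ?cycle_subG ?(subsetP nH'H) //.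
  by rewrite quotient_cycle ?cycle_cyclic // (subsetP nH'H).
have [oMH' oHM] : #|M : H^`(1)| = p /\ #|H : M| = p.
  have /p_natP[u Du] : p.-nat #|H : M| := pnat_dvd (dvdn_indexg _ _) pH.
  have /p_natP[v Dv] : p.-nat #|M : H^`(1)|.
    exact: pnat_dvd (dvdn_indexg _ _) (pgroupS sMH pH).
  have u_gt0 : (0 < u)%N.
    rewrite lt0n; apply: contra M'y => /eqP u0; apply: subsetP Hy.
    by rewrite -indexg_eq1 Du u0.
  have v_gt0 : (0 < v)%N.
    rewrite lt0n; apply: contra H'x => /eqP v0; apply: subsetP Mx.
    by rewrite -indexg_eq1 Dv v0.
  have /eqP: (p ^ u * p ^ v = p ^ 2)%N by rewrite -Du -Dv Lagrange_index.
  rewrite -expnD eqn_exp2l // Du Dv => uv.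
  have [-> ->] : u = 1%N /\ v = 1%N by move: uv u_gt0 v_gt0; clear; lia.
  by rewrite expn1.
have xpH' : x ^+ p \in H^`(1) by rewrite -[p]oMH' expg_index.
have maxM : maximal M H by rewrite p_index_maximal ?oHM.
have defMy : M * <[y]> = H.
  by apply: mulg_normal_maximal; rewrite ?cycle_subG.
have sH'Phi : H^`(1) \subset 'Phi(H) by rewrite (Phi_joing pH) joing_subl.
have defH : <[x]> <*> <[y]> = H.
  rewrite -[LHS]genGid; apply: Phi_nongen; apply/eqP; rewrite eqEsubset.
  rewrite join_subG Phi_sub join_subG !cycle_subG Hx Hy /=.
  suffices: M * <[y]> \subset 'Phi(H) <*> (<[x]> <*> <[y]>) by rewrite defMy.
  rewrite mul_subG //.
    rewrite join_subG (subset_trans sH'Phi) ?joing_subl // andbT.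
    by rewrite (subset_trans (joing_subl _ <[y]>)) ?joing_subr.
  by rewrite (subset_trans (joing_subr <[x]> _)) ?joing_subr.
have Zxy : [~ x, y] \in 'Z(H) by rewrite (subsetP sH'Z) // mem_commg.
have := @der1_joing_cycles _ x y; rewrite /= defH => -> //; last first.
  by case/setIP: Zxy.
have /centerP[_ cxy] := Zxy.
rewrite -orderE dvdn_leq // order_dvdn -commXg; last exact/commute_sym/cxy.
by apply/commgP; have /centerP[_] := subsetP sH'Z _ xpH'; apply.
Qed.

Lemma lcn2_lcn3_index gT (G : {group gT}) p :
    prime p -> p.-group G -> #|G : G^`(1)| = (p ^ 2)%N ->
  (#|G^`(1) : 'L_3(G)| <= p)%N.
Proof.
move=> p_pr pG oGG'; have nL3G := lcn_norm 3 G.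
have sL3G' : 'L_3(G) \subset G^`(1) by rewrite -lcn2 lcn_subS.
have nL3G' : G^`(1) \subset 'N('L_3(G)) := subset_trans (der_sub 1 G) nL3G.
have DH' : (G / 'L_3(G))^`(1) = G^`(1) / 'L_3(G) by rewrite -quotient_der.
rewrite -card_quotient // -DH'.
apply: card_der1_class2 (quotient_pgroup _ pG) _ _ => //.
  have := morphim_lcn (coset_morphism 'L_3(G)) 3 nL3G => /= <-.
  exact: trivg_quotient.
by rewrite DH' index_quotient_eq ?der_sub // subIset // sL3G' orbT.
Qed.

(** Take [Q] of index [p] in [N] and normal in [G]. *)
Lemma normal_index_prime gT (G N : {group gT}) p :
    prime p -> p.-group G -> N <| G -> N :!=: 1 ->
  exists2 Q : {group gT}, Q <| G & ~~ (N \subset Q) /\ #|G : Q| = (#|G : N| * p)%N.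
Proof.
move=> p_pr pG nsNG ntN; have pN := pgroupS (normal_sub nsNG) pG.
have /p_natP[n oN] : p.-nat #|N| := pN.
have n_gt0 : (0 < n)%N.
  by rewrite lt0n; apply: contra ntN => /eqP n0; rewrite trivg_card1 oN n0.
have [|Q [sQN nsQG oQ]] := @normal_pgroup p _ n.-1 G N pG nsNG.
  by rewrite oN pfactorK // leq_pred.
have oNQ : #|N : Q| = p.
  by rewrite -divgS // oN oQ -{1}(prednK n_gt0) expnS mulnK ?expn_gt0 ?prime_gt0.
exists Q => //; split; first by rewrite -indexg_eq1 oNQ gtn_eqF ?prime_gt1.
by rewrite -(Lagrange_index (normal_sub nsNG) sQN) oNQ.
Qed.

(** Subgroups of index p in L_2 and in L_3 give quotients of order p^3 and at most p^4 in which L_2,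
    respectively L_3, survives. *)
Lemma codeg_index_der1_sq gT (G : {group gT}) p :
    prime p -> p.-group G -> #|G : G^`(1)| = (p ^ 2)%N -> 'L_3(G) != 1 ->
  (exists i : Iirr G, codeg i = (p ^ 2)%:R%R)
  /\ (exists i : Iirr G, codeg i = (p ^ 3)%:R%R).
Proof.
move=> p_pr pG oGG' ntL3; split.
  have ntL2 : ('L_2(G))%G :!=: 1 by apply: contra ntL3 => /eqP/lcnS_eq1->.
  have [Q nsQG [sL2Q oGQ]] := normal_index_prime p_pr pG (lcn_normal 2 G) ntL2.
  apply: (codeg_small_quotient p_pr pG nsQG _ _ sL2Q) => //.
  by rewrite oGQ /= lcn2 oGG' -expnSr.
have [Q nsQG [sL3Q oGQ]] := normal_index_prime p_pr pG (lcn_normal 3 G) ntL3.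
apply: (codeg_small_quotient p_pr pG nsQG _ _ sL3Q) => //.
have sL3G' : 'L_3(G) \subset G^`(1) by rewrite -lcn2 lcn_subS.
rewrite oGQ /= -(Lagrange_index (der_sub 1 G) sL3G') oGG' !expnSr expn0 mul1n.
by rewrite leq_pmul2r ?prime_gt0 // leq_pmul2l ?muln_gt0 ?prime_gt0 // lcn2_lcn3_index.
Qed.

(** * Degree restrictions and the case of four codegrees *)

Lemma mem_cd gT (G : {group gT}) (i : Iirr G) : 'chi_i 1 \in cd G.
Proof. by rewrite mem_undup; apply/imageP; exists i. Qed.

Lemma mem_cod gT (G : {group gT}) (i : Iirr G) : codeg i \in cod G.
Proof. by rewrite mem_undup; apply/imageP; exists i. Qed.

(** Nonlinear degrees are all equal in the first case, and are p or p^2 in the second. *)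
Lemma degree_gap gT (G : {group gT}) p (i j : Iirr G) d e :
    prime p ->
    size (cd G) = 2%N \/ cd G =i [:: 1; p%:R; (p ^ 2)%:R]%R ->
    'chi_i 1 = (p ^ d)%:R%R -> 'chi_j 1 = (p ^ e)%:R%R ->
    (0 < d)%N -> (0 < e)%N ->
  (d <= e.+1)%N.
Proof.
move=> p_pr cdG Di Dj d_gt0 e_gt0; case: cdG => [sz2 | cdG]; last first.
  have := mem_cd i; rewrite cdG Di !inE natr_exp_eq1 // natr_exp_eqp //.
  by rewrite eq_natr_exp //; move: e_gt0; clear; lia.
suffices -> : d = e by [].
apply/eqP; apply: contraT => ne_de.
pose degs : seq algC := [:: 1; (p ^ d)%:R; (p ^ e)%:R]%R.
have uniq_degs : uniq degs.
  rewrite /= !inE !(eq_sym 1%R) !natr_exp_eq1 // eq_natr_exp // ne_de.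
  by move: d_gt0 e_gt0; clear; lia.
have /(uniq_leq_size uniq_degs) : {subset degs <= cd G}; last by rewrite sz2.
move=> x; rewrite !inE => /or3P[]/eqP->; last by rewrite -Dj mem_cd.
  by rewrite -(cfun11 G) -irr0 mem_cd.
by rewrite -Di mem_cd.
Qed.

End PGroupCodegrees.

Theorem theorem1p1 (gT : finGroupType) (G : {group gT}) (p a b : nat) :
  prime p -> (p.-group G)%g -> (2 <= b)%N -> (b < a)%N ->
  cod G =i [:: 1; p%:R; (p ^ b)%:R; (p ^ a)%:R] ->
  [\/ size (cd G) = 2%N,
      cd G =i [:: 1; p%:R; (p ^ 2)%:R]
    | #|G : G^`(1)|%g = (p ^ 2)%N] ->
  (nil_class G <= 4)%N.
Proof.
move=> p_pr pG b_gt1 lt_ba codG cases; have nilG := pgroup_nil pG.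
have exp_codG (j : Iirr G) m :
    codeg j = (p ^ m)%:R -> [|| m == 0, m == 1, m == b | m == a]%N.
  move=> Dj; have := mem_cod j; rewrite codG Dj !inE.
  by rewrite natr_exp_eq1 // natr_exp_eqp // !eq_natr_exp.
have [/andP[/eqP b2 /eqP a3] | not_b2a3] := boolP ((b == 2) && (a == 3))%N.
  apply: nil_class_codeg_le3 p_pr pG _ => j m /exp_codG.
  by rewrite b2 a3; clear; lia.
(* Since 2 <= b < a, codegrees p^2 and p^3 force b = 2 and a = 3. *)
have no_p2p3 : (exists i : Iirr G, codeg i = (p ^ 2)%:R) ->
    (exists i : Iirr G, codeg i = (p ^ 3)%:R) -> False.
  move=> [i /exp_codG i2] [j /exp_codG j3].
  by move: i2 j3 not_b2a3 b_gt1 lt_ba; clear; lia.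
have{cases} [cdG | oGG'] : (size (cd G) = 2%N \/ cd G =i [:: 1; p%:R; (p ^ 2)%:R])
    \/ #|G : G^`(1)|%g = (p ^ 2)%N.
- by case: cases => ?; [left; left | left; right | right].
- apply/lcn_nil_classP=> //; apply/trivgP; apply: contraT => ntL5.
  have [i5 [_ ntL5i]] := irr_separates (normal1 G) ntL5.
  have [i4 [lt45 ntL4i]] := lcn_cfker_lift p_pr pG ntL5i.
  have [i3 [lt34 ntL3i]] := lcn_cfker_lift p_pr pG ntL4i.
  have [j [s3j codj]] := codeg_fourth b p_pr pG ntL3i.
  have le_j3 : (#|G : cfker 'chi_j| <= #|G : cfker 'chi_i3|)%g%N.
    by rewrite dvdn_leq ?indexgS.
  have [n5 d5 _ Dn5 _ Dd5 Dc5 _ _ d5_gt0 _] := codegP i5 p_pr pG.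
  have [n4 _ _ Dn4 _ _ _ _ _ _ _] := codegP i4 p_pr pG.
  have [n3 _ _ Dn3 _ _ _ _ _ _ _] := codegP i3 p_pr pG.
  have [n d z Dn _ Dd Dc le_n _ d_gt0 _] := codegP j p_pr pG.
  rewrite (lcn_not_sub_der1 _ ntL5i) // in d5_gt0.
  rewrite Dn3 Dn4 ltn_exp2l ?prime_gt1 // in lt34.
  rewrite Dn4 Dn5 ltn_exp2l ?prime_gt1 // in lt45.
  rewrite Dn Dn3 leq_exp2l ?prime_gt1 // in le_j3.
  have Da : (n - d = a)%N.
    move: (exp_codG _ _ Dc) codj; rewrite Dc !inE natr_exp_eq1 //.
    by rewrite natr_exp_eqp // eq_natr_exp //; clear; lia.
  (* A linear character of codegree p^a with a >= 3 would make p^2 and p^3 codegrees. *)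
  have {}d_gt0 : (0 < d)%N.
    rewrite lt0n; apply/eqP=> d0; rewrite d0 ltnn in d_gt0.
    have sG'j : (G^`(1) \subset cfker 'chi_j)%g by apply: negbFE.
    have lin := codeg_linear p_pr sG'j Dn.
    by case: no_p2p3; apply: lin; move: Da b_gt1 lt_ba; clear; lia.
  (* Two strict inclusions give n5 >= n + 2 = a + d + 2, whereas n5 <= a + d5 <= a + d + 1. *)
  have := degree_gap p_pr cdG Dd5 Dd d5_gt0 d_gt0.
  move: (exp_codG _ _ Dc5) Da d_gt0 le_n lt34 lt45 le_j3 b_gt1 lt_ba.
  by clear; lia.
- have [L3 | ntL3] := eqVneq 'L_3(G)%g 1%g.
    by apply: leq_trans (_ : 2 <= 4)%N => //; apply/lcn_nil_classP.
  by case: no_p2p3; case: (codeg_index_der1_sq p_pr pG oGG' ntL3).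
Qed.
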